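(* Let $\mathbb{K}=\mathbb{R}$ or $\mathbb{C}$, let $0<r<n$ and $1\le s<n-r$, and let $A=\begin{pmatrix} I_r & 0 \\ 0 & 0 \end{pmatrix}$, $B=\begin{pmatrix} 0 & 0 \\ 0 & B' \end{pmatrix}$ in $M_n(\mathbb{K})$, where $B'=\begin{pmatrix} I_s & 0 \\ 0 & 0 \end{pmatrix}$ is an $(n-r)\times(n-r)$ matrix (so $A,B$ are idempotent, $AB=BA=0$, $s=\operatorname{rank}(B)$, and $\operatorname{rank}(A)<\operatorname{nullity}(B)$). Then any solution $X\in M_n(\mathbb{K})$ of the system $XAX=BXB$, $XBX=AXA$, partitioned into blocks conformally with $A$ (so that $C$ is $r\times(n-r)$, $D$ is $(n-r)\times r$ and $Y_2$ is $(n-r)\times(n-r)$), has one of the following forms. (a) $X=\begin{pmatrix} 0 & C \\ D & Y_2 \end{pmatrix}$ with $DC=B'Y_2B'$, $CB'D=0$, $CB'Y_2=0$, $Y_2B'D=0$, $Y_2B'Y_2=0$. (b) $X=\begin{pmatrix} Y_1 & C \\ D & Y_2 \end{pmatrix}$, where $Y_1=UJU^{-1}$ for some $U\in GL_r(\mathbb{K})$ and some $r\times r$ matrix $J$ of type $\mathcal{J}$, and for $Z=U^{-1}C$, $W=DU$ one has $JZ=0$, $WJ=0$, $DC=B'Y_2B'$, $ZB'W=J$, $CB'Y_2=0$, $Y_2B'D=0$, $Y_2B'Y_2=0$.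
   Context: Let $J_2=\begin{pmatrix} 0 & 1 \\ 0 & 0 \end{pmatrix}$. A square matrix is said to be of type $\mathcal{J}$ if it is a block diagonal matrix of the form $\operatorname{diag}(J_2,J_2,\dots,J_2,0,0,\dots,0)$, with some number of $J_2$ blocks followed by zeros on the diagonal. *)

(* Defs.v *)
From HB Require Import structures.
From mathcomp Require Import all_boot all_order all_algebra.
From mathcomp Require Import reals complex.
Set Implicit Arguments.
Unset Strict Implicit.
Unset Printing Implicit Defensive.
Import GRing.Theory.
Local Open Scope ring_scope.

Definition J2 (K : fieldType) : 'M[K]_2 := delta_mx 0 1.

Inductive type_J (K : fieldType) : forall n : nat, 'M[K]_n -> Prop :=
| type_J_zero (n : nat) : type_J (0 : 'M[K]_n)
| type_J_cons (n : nat) (M : 'M[K]_n) :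
    type_J M -> type_J (block_mx (J2 K) 0 0 M : 'M[K]_(2 + n)).

(* Main.v *)
Require Import Defs.
From HB Require Import structures.
From mathcomp Require Import all_boot all_order all_algebra.
From mathcomp Require Import reals complex.
Set Implicit Arguments.
Unset Strict Implicit.
Unset Printing Implicit Defensive.
Import GRing.Theory.
Local Open Scope ring_scope.

(** Comparing the blocks of the two equations yields [Y1 Y1 = 0], [Y1 C = 0],
    [D Y1 = 0], [C B' D = Y1] and the remaining identities of form (b) verbatim,
    so every solution is of form (b) once [Y1] is brought to type J.  A nonzero
    square-zero matrix [N] admits [v], [f] with [v N f = 1]; the span of
    [v, v N] carries a block [J2] and [{x | x f = 0, x N f = 0}] is an
    [N]-stable complement, on which one recurses. *)

(** Trades the row count [\rank A] of [row_base A] for a prescribed [m], so that a kernel basis can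
    fill a matrix of known size. *)
Lemma row_free_basis (K : fieldType) (m n p : nat) (A : 'M[K]_(p, n)) :
  \rank A = m -> exists2 L : 'M[K]_(m, n), row_free L & (L :=: A)%MS.
Proof.
move<-; exists (row_base A); [exact: row_base_free | exact: eq_row_base].
Qed.

Lemma nonzero_mx_pairing (K : fieldType) (m n : nat) (N : 'M[K]_(m, n)) :
  N != 0 ->
  exists (v : 'rV[K]_m) (f : 'cV[K]_n), v *m N *m f = 1%:M.
Proof.
case/matrix0Pn=> i [j Nij]; exists (delta_mx 0 i), ((N i j)^-1 *: delta_mx j 0).
rewrite -scalemxAr -rowE -colE; apply/matrixP=> a b.
by rewrite !ord1 !mxE eqxx mulVf.
Qed.

(** Vectors are rows: those of [V] form the new basis, [v] and [v *m N] first. The equation [e] is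
    carried along because [n] need not have the syntactic form [2 + m]. *)
Lemma square_zero_split_J2 (K : fieldType) (n : nat) (N : 'M[K]_n) :
  N *m N = 0 -> N != 0 ->
  exists (m : nat) (e : n = (2 + m)%N) (V : 'M[K]_(2 + m)) (M : 'M[K]_m),
    [/\ V \in unitmx, M *m M = 0 &
        V *m castmx (e, e) N = block_mx (J2 K) 0 0 M *m V].
Proof.
move=> N2 /nonzero_mx_pairing[v [f vNf]].
pose P := col_mx v (v *m N).
pose Q := row_mx f (N *m f).
have PN : P *m N = (J2 K : 'M_(1 + 1)) *m P.
  have -> : (J2 K : 'M_(1 + 1)) = block_mx 0 1%:M 0 0.
    apply/matrixP=> i j; rewrite !mxE -!val_eqE /=.
    by do 2![case: splitP => ? ->; rewrite ord1 !mxE].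
  rewrite mul_col_mx mul_block_col !mul0mx !mul1mx add0r addr0.
  by rewrite -mulmxA N2 mulmx0.
(* As [N *m N = 0], the product has rows [(v *m f, 1)] and [(1, 0)], with the explicit inverse given
   below. *)
have PQ : row_free (P *m Q).
  rewrite row_free_unit /P /Q mul_col_row !mulmxA vNf.
  rewrite -(mulmxA v N N) N2 mulmx0 mul0mx.
  apply: (mulmx1_unit
    (B := block_mx 0 1%:M 1%:M (- (v *m f)) ) _).1.
  rewrite mulmx_block !mulmx0 !mul0mx !mulmx1 !mul1mx !add0r !addr0 subrr.
  by rewrite -scalar_mx_block.
have Pfree : row_free P.
  rewrite /row_free eqn_leq rank_leq_row.
  by apply: leq_trans (mxrankM_maxl P Q); rewrite (eqP PQ).
have rQ : \rank Q = 2.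
  apply/eqP; rewrite eqn_leq rank_leq_col.
  by apply: leq_trans (mxrankM_maxr P Q); rewrite (eqP PQ).
(* Ensures that the truncated [n - 2] is a genuine difference. *)
have n_ge2 : (2 <= n)%N by have := rank_leq_col P; rewrite (eqP Pfree).
have e : n = (2 + (n - 2))%N by rewrite subnKC.
have rker : \rank (kermx Q) = (n - 2)%N by rewrite mxrank_ker rQ.
have [L Lfree eqL] := row_free_basis rker.
have LQ : L *m Q = 0 by apply/sub_kermxP; rewrite eqL.
have /submxP[M LN] : (L *m N <= L)%MS.
  rewrite eqL; apply/sub_kermxP.
  (* The columns of [L *m N *m Q] are [L *m N *m f], zero by [LQ], and [L *m N *m N *m f], zero by
     [N2]. *)
  move: LQ; rewrite /Q mul_mx_row -[0]row_mx0 => /eq_row_mx[_ LNf].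
  rewrite mul_mx_row -(mulmxA L N f) LNf !mulmxA -(mulmxA L N N) N2.
  by rewrite mulmx0 mul0mx row_mx0.
have M2 : M *m M = 0.
  apply: (row_free_inj Lfree).
  by rewrite mul0mx -mulmxA -LN mulmxA -LN -mulmxA N2 mulmx0.
have VN : col_mx P L *m N = block_mx (J2 K) 0 0 M *m col_mx P L.
  by rewrite mul_col_mx mul_block_col !mul0mx addr0 add0r PN LN.
have Vfree : row_free (col_mx P L).
  rewrite -kermx_eq0; apply/rowV0P=> x /sub_kermxP.
  rewrite -[x]hsubmxK mul_row_col => x0.
  (* Multiplying a linear relation by [Q] kills the [L] part; the [P] coefficients then vanish since
     [P *m Q] is invertible. *)
  have /(congr1 (mulmx^~ Q)) := x0.
  rewrite /= mulmxDl -!mulmxA LQ mulmx0 addr0 mul0mx => xl.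
  have xl0 : lsubmx x = 0 by apply: (row_free_inj PQ); rewrite mul0mx.
  move: x0; rewrite xl0 mul0mx add0r => xr.
  have -> : rsubmx x = 0 by apply: (row_free_inj Lfree); rewrite mul0mx.
  exact: row_mx0.
exists (n - 2)%N, e, (castmx (erefl, e) (col_mx P L)), M.
move: (col_mx P L) (block_mx _ _ _ M) VN Vfree => V T.
(* With the size generalized to a variable, [e] can be eliminated and the casts become trivial. *)
move: (2 + (n - 2))%N e V T => k e; case: k / e => V T VN Vfree.
by rewrite !castmx_id -row_free_unit.
Qed.

Lemma square_zero_similar_type_J (K : fieldType) (n : nat) (N : 'M[K]_n) :
  N *m N = 0 ->
  exists U J : 'M[K]_n, [/\ U \in unitmx, type_J J & N *m U = U *m J].
Proof.
have [k] := ubnP n; elim: k n N => // k IHk n N lt_nk N2.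
have [->|N_neq0] := eqVneq N 0.
  exists 1%:M, 0; split; [exact: unitmx1 | exact: type_J_zero |].
  by rewrite mul0mx mulmx0.
have [m [e [V [M [Vunit M2]]]]] := square_zero_split_J2 N2 N_neq0.
subst n; rewrite castmx_id => VN.
have [|U [J [Uunit typeJ MU]]] := IHk m M _ M2.
  by rewrite ltnS in lt_nk; apply: leq_trans lt_nk; exact: leq_addl 1 m.+1.
(* [V] acts on rows but [U] on columns, hence the inverse; the identity block leaves [J2]
   untouched. *)
exists (invmx V *m block_mx 1%:M 0 0 U), (block_mx (J2 K) 0 0 J); split.
- rewrite unitmx_mul unitmx_inv Vunit /= unitmxE det_ublock det1 mul1r.
  by rewrite -unitmxE.
- exact: type_J_cons.
have NV : N *m invmx V = invmx V *m block_mx (J2 K) 0 0 M.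
  by rewrite -[N](mulKmx Vunit) VN !mulmxA mulmxK.
rewrite mulmxA NV -!mulmxA !mulmx_block.
by rewrite !mulmx0 !mul0mx !mulmx1 !mul1mx !addr0 !add0r MU.
Qed.

Theorem theorem5p3 (R : realType) (K : fieldType)
    (hK : K = (R : fieldType) \/ K = (R[i] : fieldType))
    (n r s : nat) (hr : (0 < r < n)%N) (hs : (1 <= s < n - r)%N)
    (X : 'M[K]_(r + (n - r))) :
  let A : 'M[K]_(r + (n - r)) := block_mx 1%:M 0 0 0 in
  let B' : 'M[K]_(n - r) := pid_mx s in
  let B : 'M[K]_(r + (n - r)) := block_mx 0 0 0 B' in
  X *m A *m X = B *m X *m B ->
  X *m B *m X = A *m X *m A ->
  (exists (C : 'M[K]_(r, n - r)) (D : 'M[K]_(n - r, r)) (Y2 : 'M[K]_(n - r)),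
     X = block_mx 0 C D Y2 /\
     D *m C = B' *m Y2 *m B' /\
     C *m B' *m D = 0 /\
     C *m B' *m Y2 = 0 /\
     Y2 *m B' *m D = 0 /\
     Y2 *m B' *m Y2 = 0)
  \/
  (exists (Y1 : 'M[K]_r) (C : 'M[K]_(r, n - r)) (D : 'M[K]_(n - r, r))
          (Y2 : 'M[K]_(n - r)) (U J : 'M[K]_r),
     X = block_mx Y1 C D Y2 /\
     U \in unitmx /\
     type_J J /\
     Y1 = U *m J *m invmx U /\
     let Z := invmx U *m C in
     let W := D *m U in
     J *m Z = 0 /\
     W *m J = 0 /\
     D *m C = B' *m Y2 *m B' /\
     Z *m B' *m W = J /\
     C *m B' *m Y2 = 0 /\
     Y2 *m B' *m D = 0 /\
     Y2 *m B' *m Y2 = 0).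
Proof.
move=> A B' B; rewrite -[X]submxK /A /B.
move: (ulsubmx X) (ursubmx X) (dlsubmx X) (drsubmx X) => Y1 C D Y2.
rewrite !mulmx_block !mulmx0 !mul0mx !mulmx1 !mul1mx !addr0 !add0r.
rewrite !mul0mx !addr0 !add0r.
case/eq_block_mx=> Y1Y1 Y1C DY1 DC /eq_block_mx[CBD CBY YBD YBY].
have [U [J [Uunit typeJ YU]]] := square_zero_similar_type_J Y1Y1.
have UJ : J = invmx U *m Y1 *m U by rewrite -mulmxA YU mulKmx.
(* Form (a) is the instance [J = 0] of form (b), so no case split is made. *)
right; exists Y1, C, D, Y2, U, J => /=.
do !split => //.
- by rewrite -YU mulmxK.
- by rewrite UJ !mulmxA mulmxK // -mulmxA Y1C mulmx0.
- by rewrite -mulmxA -YU mulmxA DY1 mul0mx.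
- by rewrite UJ -CBD !mulmxA.
Qed.
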